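(* (Global cover theorem) For every instance of the Square Strip Packing Problem and every ordering of its squares, the unoccupied space of the bottom-left packing within the substrip $[0,W]\times[0,h_{\text{BL}}-3h_{\text{max}}]$ can be covered by at most twelve copies of the squares of the instance; that is, there is a family of translates of the squares, in which each square of the instance is used at most twelve times, whose union contains all points of $[0,W]\times[0,h_{\text{BL}}-3h_{\text{max}}]$ not covered by the packed squares.
   Context: Square Strip Packing Problem: squares with side lengths at most $W$ are to be packed without rotation into the strip $[0,W]\times[0,\infty)$ with pairwise disjoint interiors. Bottom-left algorithm: given an ordering, place the first square at $(0,0)$ and each subsequent square at a feasible position $(x,y)$ (its lower-left corner) with $(y,x)$ lexicographically minimal. $h_{\text{BL}}$ is the height (maximum top coordinate) of the resulting packing and $h_{\text{max}}$ the largest side length of a square in the instance. *)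

(* Defs.v *)
From Stdlib Require Import Reals List.
Open Scope R_scope.

Definition in_sq (x y : R) (p : R * R) (a : R) : Prop :=
  fst p <= x <= fst p + a /\ snd p <= y <= snd p + a.

Definition in_int (x y : R) (p : R * R) (a : R) : Prop :=
  fst p < x < fst p + a /\ snd p < y < snd p + a.

Definition disjoint_interiors (p : R * R) (a : R) (q : R * R) (b : R) : Prop :=
  ~ (exists x y, in_int x y p a /\ in_int x y q b).

Definition side (s : list R) (i : nat) : R := nth i s 0.

Definition feasible (W : R) (s : list R) (pos : nat -> R * R) (i : nat)
    (p : R * R) : Prop :=
  0 <= fst p /\ fst p + side s i <= W /\ 0 <= snd p /\
  forall j, (j < i)%nat -> disjoint_interiors (pos j) (side s j) p (side s i).

Definition lex_le (p q : R * R) : Prop :=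
  snd p < snd q \/ (snd p = snd q /\ fst p <= fst q).

Definition is_BL (W : R) (s : list R) (pos : nat -> R * R) : Prop :=
  forall i, (i < length s)%nat ->
    feasible W s pos i (pos i) /\
    forall q, feasible W s pos i q -> lex_le (pos i) q.

Definition h_BL (s : list R) (pos : nat -> R * R) : R :=
  fold_right Rmax 0 (map (fun i => snd (pos i) + side s i) (seq 0 (length s))).

Definition h_max (s : list R) : R := fold_right Rmax 0 s.

(* Main.v *)
(** For a height [y], consider the sizes [r] for which some empty [r]-square of
    the final packing has its bottom below [y + 2r].  Take the largest such [r]
    among the sizes [h_max * (2/3)^k]; it exists as soon as some point at height
    [y] is uncovered, and it is less than [h_max], since otherwise the topmost
    square would have been placed lower.  The bottom-left rule makes every square
    with bottom at or above [y + 2r] larger than [r], so every square reaching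
    [y + 3r] is larger than [r].  By maximality of [r] a square of side [3r/2]
    with bottom just below [y + 3r] is blocked wherever it is put horizontally, so
    every point at height [y] lies, up to [3r/2] horizontally, below or beside a
    blocking square of side [a > r] whose bottom is less than [9r/2] above [y] and
    whose top is at least [3r] above [y].  As [r] is nondecreasing in [y], the
    heights [y] served by a given square span less than [5a/2]; horizontally it
    serves a range of width at most [4a].  Hence a grid of 4 by 3 copies
    suffices. *)
Require Import Defs.
From Stdlib Require Import Reals List.
From Stdlib Require Import Lra Lia Classical Wf_nat IndefiniteDescription.
Open Scope R_scope.

(** * Maxima of lists and grids of translates *)

Lemma fold_Rmax_ge (l : list R) (a : R) : In a l -> a <= fold_right Rmax 0 l.
Proof.
  induction l as [|b l IH]; simpl; [easy|].
  pose proof (Rmax_l b (fold_right Rmax 0 l)).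
  pose proof (Rmax_r b (fold_right Rmax 0 l)).
  intros [->|H']; [lra|]. specialize (IH H'). lra.
Qed.

Lemma fold_Rmax_attained (l : list R) :
  fold_right Rmax 0 l = 0 \/ In (fold_right Rmax 0 l) l.
Proof.
  induction l as [|b l IH]; simpl; [now left|].
  destruct (Rle_lt_dec b (fold_right Rmax 0 l)).
  - rewrite Rmax_right by lra. tauto.
  - rewrite Rmax_left by lra. tauto.
Qed.

Lemma h_BL_attained (s : list R) (pos : nat -> R * R) :
  h_BL s pos = 0 \/
  exists i, (i < length s)%nat /\ h_BL s pos = snd (pos i) + side s i.
Proof.
  unfold h_BL.
  destruct (fold_Rmax_attained
    (map (fun i => snd (pos i) + side s i) (seq 0 (length s)))) as [H|H].
  - now left.
  - right. apply in_map_iff in H. destruct H as [i [H1 H2]].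
    apply in_seq in H2. exists i. split; [lia|now symmetry].
Qed.

Lemma side_le_h_max (s : list R) (i : nat) :
  (i < length s)%nat -> side s i <= h_max s.
Proof. intros Hi. apply fold_Rmax_ge, nth_In, Hi. Qed.

Definition grid (m n : nat) (a : R) (p : R * R) : list (R * R) :=
  list_prod (map (fun c => fst p + INR c * a) (seq 0 m))
            (map (fun d => snd p + INR d * a) (seq 0 n)).

Lemma length_grid (m n : nat) (a : R) (p : R * R) :
  length (grid m n a p) = (m * n)%nat.
Proof. unfold grid. now rewrite length_prod, !length_map, !length_seq. Qed.

Lemma interval_step (m : nat) (a u : R) :
  0 <= u <= INR (S m) * a ->
  exists c, (c < S m)%nat /\ INR c * a <= u <= INR c * a + a.
Proof.
  induction m as [|m IH]; intros Hu.
  - exists 0%nat. simpl in *. split; [lia|lra].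
  - destruct (Rle_lt_dec u (INR (S m) * a)) as [H|H].
    + destruct IH as [c [Hc H']]; [lra|]. exists c. split; [lia|lra].
    + exists (S m). rewrite (S_INR (S m)) in Hu. split; [lia|lra].
Qed.

Lemma grid_cover (m n : nat) (a : R) (p : R * R) (x y : R) :
  fst p <= x <= fst p + INR (S m) * a ->
  snd p <= y <= snd p + INR (S n) * a ->
  exists c, In c (grid (S m) (S n) a p) /\ in_sq x y c a.
Proof.
  intros Hx Hy.
  destruct (interval_step m a (x - fst p)) as [c [Hc Hcx]]; [lra|].
  destruct (interval_step n a (y - snd p)) as [d [Hd Hdy]]; [lra|].
  exists (fst p + INR c * a, snd p + INR d * a). split.
  - apply in_prod.
    + apply (in_map (fun c => fst p + INR c * a)), in_seq; lia.
    + apply (in_map (fun d => snd p + INR d * a)), in_seq; lia.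
  - unfold in_sq; simpl; lra.
Qed.

Lemma least_nat (P : nat -> Prop) :
  (exists n, P n) -> exists n, P n /\ forall m, P m -> (n <= m)%nat.
Proof.
  intros H.
  destruct (dec_inh_nat_subset_has_unique_least_element P
              (fun n => classic (P n)) H) as [n [Hn _]].
  now exists n.
Qed.

(** Take [z] to be the maximum of [y] and of the values below [t]. A square resting at height [z]
    can then only meet squares whose tops reach [t]. *)
Lemma finite_gap_below (f : nat -> R) (n : nat) (y t : R) :
  y < t ->
  exists z, y <= z < t /\ forall i, (i < n)%nat -> f i < t -> f i <= z.
Proof.
  intros Hyt. induction n as [|n [z [Hz IH]]].
  - exists y. split; [lra|lia].
  - destruct (Rlt_le_dec (f n) t) as [H|H].
    + exists (Rmax z (f n)).
      pose proof (Rmax_l z (f n)). pose proof (Rmax_r z (f n)).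
      split.
      * split; [lra|]. apply Rmax_lub_lt; lra.
      * intros i Hi Hf. destruct (Nat.eq_dec i n) as [->|Hne]; [lra|].
        specialize (IH i ltac:(lia) Hf). lra.
    + exists z. split; [lra|]. intros i Hi Hf.
      destruct (Nat.eq_dec i n) as [->|Hne]; [lra|]. apply IH; [lia|lra].
Qed.

(** * Neighbourhoods of uncovered points *)

Lemma not_in_sq_near (x y : R) (p : R * R) (a : R) :
  ~ in_sq x y p a ->
  exists d, 0 < d /\ forall u v, x - d < u < x + d -> y - d < v < y + d ->
    ~ in_sq u v p a.
Proof.
  unfold in_sq. intros H.
  destruct (Rlt_le_dec x (fst p)).
  { exists (fst p - x). split; [lra|]. intros; lra. }
  destruct (Rlt_le_dec (fst p + a) x).
  { exists (x - (fst p + a)). split; [lra|]. intros; lra. }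
  destruct (Rlt_le_dec y (snd p)).
  { exists (snd p - y). split; [lra|]. intros; lra. }
  exists (y - (snd p + a)). split; [|intros; lra].
  destruct (Rlt_le_dec (snd p + a) y); [lra|]. exfalso. apply H. lra.
Qed.

Lemma uncovered_near (s : list R) (pos : nat -> R * R) (x y : R) (n : nat) :
  (forall i, (i < n)%nat -> ~ in_sq x y (pos i) (side s i)) ->
  exists d, 0 < d /\
    forall i u v, (i < n)%nat -> x - d < u < x + d -> y - d < v < y + d ->
      ~ in_sq u v (pos i) (side s i).
Proof.
  induction n as [|n IH]; intros H.
  - exists 1. split; [lra|lia].
  - destruct IH as [d [Hd IH]]. { intros i Hi; apply H; lia. }
    destruct (not_in_sq_near _ _ _ _ (H n ltac:(lia))) as [e [He He']].
    exists (Rmin d e).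
    pose proof (Rmin_l d e). pose proof (Rmin_r d e).
    split; [now apply Rmin_glb_lt|].
    intros i u v Hi Hu Hv. destruct (Nat.eq_dec i n) as [->|Hne].
    + apply He'; lra.
    + apply IH; [lia|lra|lra].
Qed.

(** * Empty squares and the bottom-left rule *)

Lemma disjoint_interiors_shrink (p : R * R) (a : R) (q : R * R) (b c : R) :
  c <= b -> disjoint_interiors p a q b -> disjoint_interiors p a q c.
Proof.
  intros Hcb H [x [y [Hp Hq]]]. apply H. exists x, y. split; [exact Hp|].
  unfold Defs.in_int in *. lra.
Qed.

(** The factor 2 suits the ratio 3/2 of consecutive sizes: squares of side at most [r] will have
    their tops below [y + 3 * r], which is the bound on the bottom for size [3 / 2 * r]. *)
Definition fits (W : R) (s : list R) (pos : nat -> R * R) (r y : R) : Prop :=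
  exists p, 0 <= fst p /\ fst p + r <= W /\ 0 <= snd p < y + 2 * r /\
    forall j, (j < length s)%nat ->
      disjoint_interiors (pos j) (side s j) p r.

Lemma fits_mono (W : R) (s : list R) (pos : nat -> R * R) (r y y' : R) :
  y <= y' -> fits W s pos r y -> fits W s pos r y'.
Proof.
  intros Hy [p [H1 [H2 [H3 H4]]]]. exists p. repeat split; try lra; auto.
Qed.

(** A place empty in the final packing was already empty when square [i] was put down, so its corner
    was feasible for [i]. *)
Lemma fits_blocks_small (W : R) (s : list R) (pos : nat -> R * R) (r y : R) (i : nat) :
  is_BL W s pos -> fits W s pos r y -> (i < length s)%nat ->
  side s i <= r -> snd (pos i) < y + 2 * r.
Proof.
  intros HBL [p [H1 [H2 [H3 H4]]]] Hi Hr.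
  destruct (HBL i Hi) as [_ Hmin].
  assert (Hf : feasible W s pos i p).
  { repeat split; try lra. intros j Hj.
    apply disjoint_interiors_shrink with r; [exact Hr|apply H4; lia]. }
  destruct (Hmin p Hf) as [H|[H _]]; lra.
Qed.

Lemma h_max_not_fits (W : R) (s : list R) (pos : nat -> R * R) (y : R) :
  is_BL W s pos -> 0 < h_max s -> 0 <= y <= h_BL s pos - 3 * h_max s ->
  ~ fits W s pos (h_max s) y.
Proof.
  intros HBL Hh Hy Hf.
  destruct (h_BL_attained s pos) as [H|[i [Hi H]]]; [lra|].
  pose proof (side_le_h_max s i Hi) as Ha.
  pose proof (fits_blocks_small _ _ _ _ _ _ HBL Hf Hi Ha). lra.
Qed.

Lemma uncovered_fits (W : R) (s : list R) (pos : nat -> R * R) (x y : R) :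
  0 < W -> 0 <= x <= W -> 0 <= y ->
  ~ (exists i, (i < length s)%nat /\ in_sq x y (pos i) (side s i)) ->
  exists d, 0 < d /\ forall r, 0 < r < d -> fits W s pos r y.
Proof.
  intros HW Hx Hy Hunc.
  destruct (uncovered_near s pos x y (length s)) as [d [Hd Hnear]].
  { intros i Hi Hin. apply Hunc. now exists i. }
  exists (Rmin d W). split; [now apply Rmin_glb_lt|].
  pose proof (Rmin_l d W). pose proof (Rmin_r d W).
  intros r Hr.
  assert (Hq : exists q, 0 <= q /\ q + r <= W /\ q <= x <= q + r).
  (* Near the right wall the square is moved left until it ends at [W]. *)
  { destruct (Rle_lt_dec (x + r) W); [exists x|exists (W - r)]; lra. }
  destruct Hq as [q Hq].
  exists (q, y). simpl. repeat split; try lra.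
  intros j Hj [u [v [Hp Hv]]]. unfold Defs.in_int in *; simpl in *.
  apply (Hnear j u v Hj); [lra|lra|]. unfold in_sq. lra.
Qed.

Lemma blocking_square (W : R) (s : list R) (pos : nat -> R * R) (r x y : R) :
  is_BL W s pos -> 0 < r -> 3 / 2 * r <= W -> 0 <= x <= W -> 0 <= y ->
  fits W s pos r y -> ~ fits W s pos (3 / 2 * r) y ->
  exists i, (i < length s)%nat /\ r < side s i /\
    fst (pos i) - 3 / 2 * r < x < fst (pos i) + side s i + 3 / 2 * r /\
    snd (pos i) - 9 / 2 * r < y /\ y + 3 * r <= snd (pos i) + side s i.
Proof.
  intros HBL Hr HrW Hx Hy Hf Hnf.
  destruct (finite_gap_below (fun i => snd (pos i) + side s i) (length s)
              y (y + 3 * r)) as [z [Hz Hgap]]; [lra|].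
  assert (Hq : exists q, 0 <= q /\ q + 3 / 2 * r <= W /\ q <= x <= q + 3 / 2 * r).
  { destruct (Rle_lt_dec (x + 3 / 2 * r) W); [exists x|exists (W - 3 / 2 * r)]; lra. }
  destruct Hq as [q Hq].
  (* Without a blocking square, the square of side [3 / 2 * r] at [(q, z)] would be empty. A square
     meeting it has its top above [z], hence at least [y + 3 * r], and its bottom below
     [z + 3 / 2 * r < y + 9 / 2 * r]. *)
  apply NNPP. intros Hno. apply Hnf. exists (q, z). simpl.
  repeat split; try lra.
  intros i Hi [u [v [Hp Hv]]]. unfold Defs.in_int in *; simpl in *.
  apply Hno. exists i.
  assert (Htop : y + 3 * r <= snd (pos i) + side s i).
  { apply Rnot_lt_le. intros H. pose proof (Hgap i Hi H) as H'. simpl in H'. lra. }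
  assert (Hbig : r < side s i).
  { apply Rnot_le_lt. intros H.
    pose proof (fits_blocks_small _ _ _ _ _ _ HBL Hf Hi H). lra. }
  repeat split; auto; lra.
Qed.

(** * Geometric scale of sizes *)

Definition scale (s : list R) (k : nat) : R := h_max s * (2 / 3) ^ k.

(** Sizes decrease in [k], so the least exponent gives the largest size; restricting to a discrete
    scale makes this maximum attained. *)
Definition level (W : R) (s : list R) (pos : nat -> R * R) (y : R) (k : nat) : Prop :=
  fits W s pos (scale s k) y /\
  forall m, fits W s pos (scale s m) y -> (k <= m)%nat.

Lemma scale_pos (s : list R) (k : nat) : 0 < h_max s -> 0 < scale s k.
Proof. intros H. apply Rmult_lt_0_compat; [exact H|apply pow_lt; lra]. Qed.

Lemma scale_S (s : list R) (k : nat) : scale s k = 3 / 2 * scale s (S k).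
Proof. unfold scale; simpl. field. Qed.

Lemma scale_decr (s : list R) (k m : nat) :
  0 < h_max s -> (k <= m)%nat -> scale s m <= scale s k.
Proof.
  intros H. induction 1 as [|m Hkm IH]; [lra|].
  pose proof (scale_S s m). pose proof (scale_pos s (S m) H). lra.
Qed.

Lemma scale_small (s : list R) (d : R) :
  0 < h_max s -> 0 < d -> exists k, scale s k < d.
Proof.
  intros H Hd.
  destruct (pow_lt_1_zero (2 / 3) ltac:(rewrite Rabs_pos_eq; lra) (d / h_max s))
    as [k Hk]; [now apply Rdiv_lt_0_compat|].
  exists k. specialize (Hk k (le_n k)).
  rewrite Rabs_pos_eq in Hk by (apply pow_le; lra).
  apply (Rmult_lt_compat_l (h_max s)) in Hk; [|exact H].
  replace (h_max s * (d / h_max s)) with d in Hk by (field; lra).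
  exact Hk.
Qed.

(** Free of [x], so that the rows of a grid can be chosen independently of its columns. *)
Definition served (W : R) (s : list R) (pos : nat -> R * R) (i : nat) (y : R) : Prop :=
  exists k, level W s pos y k /\ scale s k < side s i /\
    snd (pos i) - 9 / 2 * scale s k < y /\
    y + 3 * scale s k <= snd (pos i) + side s i.

(** Let [y < y'] have sizes [r] and [r']; then [r <= r']. With [a] the side, the bounds on bottom
    and top give [y' - y < a - 3 * r' + 9 / 2 * r <= a + 3 / 2 * r < 5 / 2 * a]. *)
Lemma served_span (W : R) (s : list R) (pos : nat -> R * R) (i : nat) (y y' : R) :
  0 < h_max s -> served W s pos i y -> served W s pos i y' ->
  y' <= y + 5 / 2 * side s i.
Proof.
  intros Hh [k [[Hk Hkmin] [Hka [H1 H2]]]] [m [[Hm Hmmin] [Hma [H3 H4]]]].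
  pose proof (scale_pos s k Hh).
  destruct (Rle_lt_dec y' y) as [Hy|Hy]; [lra|].
  assert (Hkm : (m <= k)%nat).
  { apply Hmmin. apply fits_mono with y; [lra|exact Hk]. }
  pose proof (scale_decr s m k Hh Hkm). lra.
Qed.

Lemma served_rows (W : R) (s : list R) (pos : nat -> R * R) (i : nat) :
  0 < h_max s ->
  exists b, forall y, served W s pos i y -> b <= y <= b + 5 / 2 * side s i.
Proof.
  intros Hh.
  destruct (classic (exists y, served W s pos i y)) as [[y0 H0]|Hno].
  (* The window ends at the supremum of the served heights. *)
  - destruct (completeness (served W s pos i)) as [M [Hub Hlub]].
    + exists (y0 + 5 / 2 * side s i). intros y Hy. now apply (served_span W s pos).
    + now exists y0.
    + exists (M - 5 / 2 * side s i). intros y Hy.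
      pose proof (Hub y Hy).
      assert (M <= y + 5 / 2 * side s i).
      { apply Hlub. intros y' Hy'. now apply (served_span W s pos). }
      lra.
  - exists 0. intros y Hy. exfalso. apply Hno. now exists y.
Qed.

Lemma uncovered_served (W : R) (s : list R) (pos : nat -> R * R) (x y : R) :
  0 < h_max s <= W -> is_BL W s pos -> 0 <= x <= W ->
  0 <= y <= h_BL s pos - 3 * h_max s ->
  ~ (exists i, (i < length s)%nat /\ in_sq x y (pos i) (side s i)) ->
  exists i, (i < length s)%nat /\ served W s pos i y /\
    fst (pos i) - 3 / 2 * side s i <= x <= fst (pos i) + 5 / 2 * side s i.
Proof.
  intros Hh HBL Hx Hy Hunc.
  destruct (uncovered_fits W s pos x y) as [d [Hd Hfits]]; try lra; auto.
  destruct (scale_small s d) as [k0 Hk0]; try lra.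
  assert (Hex : exists k, level W s pos y k).
  { apply least_nat. exists k0. apply Hfits. split; [now apply scale_pos|exact Hk0]. }
  destruct Hex as [k Hlev]. pose proof Hlev as [Hfit Hmin].
  (* Exponent 0 is the size [h_max s], which does not fit; so a next larger size exists. *)
  destruct k as [|k].
  { exfalso. apply (h_max_not_fits W s pos y HBL); try lra.
    unfold scale in Hfit. simpl in Hfit. now rewrite Rmult_1_r in Hfit. }
  assert (Hle : 3 / 2 * scale s (S k) <= h_max s).
  { rewrite <- scale_S. replace (h_max s) with (scale s 0) by (unfold scale; simpl; ring).
    apply scale_decr; [lra|lia]. }
  destruct (blocking_square W s pos (scale s (S k)) x y)
    as [i [Hi [Ha [Hxi Hyi]]]]; try lra; auto.
  - now apply scale_pos.
  - rewrite <- scale_S. intros Hf. specialize (Hmin k Hf). lia.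
  - exists i. split; [exact Hi|]. split; [|lra].
    exists (S k). tauto.
Qed.

Theorem theorem13 (W : R) (s : list R) (pos : nat -> R * R) :
  0 < W ->
  s <> nil ->
  (forall a, In a s -> 0 < a <= W) ->
  is_BL W s pos ->
  exists C : nat -> list (R * R),
    (forall i, (i < length s)%nat -> (length (C i) <= 12)%nat) /\
    forall x y,
      0 <= x <= W ->
      0 <= y <= h_BL s pos - 3 * h_max s ->
      ~ (exists i, (i < length s)%nat /\ in_sq x y (pos i) (side s i)) ->
      exists i c, (i < length s)%nat /\ In c (C i) /\ in_sq x y c (side s i).
Proof.
  intros HW Hs Hside HBL.
  assert (Hh : 0 < h_max s <= W).
  { destruct s as [|a s]; [easy|].
    pose proof (Hside a (or_introl eq_refl)).
    pose proof (side_le_h_max (a :: s) 0 (Nat.lt_0_succ _)) as H'.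
    unfold side in H'; simpl nth in H'. split; [lra|].
    destruct (fold_Rmax_attained (a :: s)) as [H0|H0]; unfold h_max in *.
    - lra.
    - now apply Hside. }
  destruct (functional_choice
    (fun i b => forall y, served W s pos i y -> b <= y <= b + 5 / 2 * side s i))
    as [b Hb].
  { intros i. apply served_rows; lra. }
  (* Four columns span the width from [- 3 / 2] to [5 / 2] sides exactly; three rows exceed the
     required [5 / 2] sides. *)
  exists (fun i => grid 4 3 (side s i) (fst (pos i) - 3 / 2 * side s i, b i)).
  split.
  - intros i _. rewrite length_grid. lia.
  - intros x y Hx Hy Hunc.
    destruct (uncovered_served W s pos x y) as [i [Hi [Hserved Hxi]]]; auto.
    specialize (Hb i y Hserved).
    destruct (Hside (side s i) (nth_In s 0 Hi)) as [Ha _].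
    (* [grid_cover] takes the predecessors of the grid dimensions. *)
    destruct (grid_cover 3 2 (side s i)
      (fst (pos i) - 3 / 2 * side s i, b i) x y) as [c [Hc Hin]];
      simpl fst; simpl snd; simpl INR; try lra.
    now exists i, c.
Qed.
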